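(* The wave function cannot be a strict scalar under Galilean boosts: there is no wave equation $$a^{\mu\nu}\partial_\mu\partial_\nu\Psi+b^\mu\partial_\mu\Psi+f\,\Psi=0$$ (with constant complex coefficients $a^{\mu\nu},b^\mu$ and a function $f(\mathbf r,t)$) that is Galilean covariant in the sense defined in the context and for which all the boost factors $g_{\mathbf v}$ are constant, i.e. for which, up to an overall constant, $\Psi(\mathbf r,t)=\Psi'(\mathbf r',t')$ after every Galilean boost.
   Context: Notation: $x^0=ct$, $(x^1,x^2,x^3)=\mathbf r=(x,y,z)$, $\partial_\mu=\partial/\partial x^\mu$, $\mu=0,1,2,3$, repeated indices are summed; $c>0$ is the speed of light. Wave equation: a homogeneous linear partial differential equation of order at most two of the form $L\Psi:=a^{\mu\nu}\partial_\mu\partial_\nu\Psi+b^\mu\partial_\mu\Psi+f\Psi=0$ for a complex-valued function $\Psi(\mathbf r,t)$, with constant coefficients $a^{\mu\nu},b^\mu$ and an arbitrary function $f(\mathbf r,t)$. It is required to actually involve time derivatives (an equation in which no time derivative of $\Psi$ appears, after combining $a^{\mu\nu}$ and $a^{\nu\mu}$, is not considered a wave equation). Frames: a rotation relates $S$ and $S'$ by $\mathbf r'=M\mathbf r$, $t'=t$, $M\in SO(3)$; a Galilean boost with velocity $\mathbf v\in\mathbb{R}^3$ by $t=t'$, $\mathbf r=\mathbf r'+\mathbf v t'$. The function $f$ is a strict scalar: $f'(\mathbf r',t')=f(\mathbf r,t)$. Under rotations wave functions transform as $\Psi(\mathbf r,t)=\Psi'(\mathbf r',t')$; under a boost with velocity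 $\mathbf v$ they transform as $\Psi(\mathbf r,t)=g_{\mathbf v}(\mathbf r',t')\Psi'(\mathbf r',t')$, where $g_{\mathbf v}$ is some smooth, nowhere vanishing complex-valued function. Galilean covariance: for every rotation and every boost, substituting the transformation law into $L\Psi$ and expressing everything in primed variables gives, for every smooth $\Psi'$, a nowhere vanishing function (independent of $\Psi'$) times $a^{\mu\nu}\partial_{\mu'}\partial_{\nu'}\Psi'+b^\mu\partial_{\mu'}\Psi'+f'\Psi'$, with the same constants $a^{\mu\nu},b^\mu$. *)

(* Defs.v *)
From HB Require Import structures.
From mathcomp Require Import all_boot all_order all_algebra.
From mathcomp Require Import complex.
From mathcomp Require Import all_classical all_reals all_analysis.

Set Implicit Arguments.
Unset Strict Implicit.
Unset Printing Implicit Defensive.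

Import Order.TTheory GRing.Theory Num.Theory.
Import numFieldNormedType.Exports.
Local Open Scope ring_scope.
Local Open Scope complex_scope.

(* An event is a pair (r, t), with the time t and not x^0 = ct as second
   component. *)
Notation event R := ('cV[R]_3 * R)%type.

Section Galilean.
Variable R : realType.
Implicit Types (p q v : event R) (Psi f g lam : event R -> R[i]).

(* Derivatives of complex-valued functions are taken componentwise, since the
   library has no normed R-module structure on R[i]. *)
Definition cderive v Psi p : R[i] :=
  'D_v (fun q => complex.Re (Psi q)) p +i* 'D_v (fun q => complex.Im (Psi q)) p.

(* C^oo: every iterated directional derivative, of every order and including
   order 0, is everywhere Frechet differentiable. *)
Definition smooth_real (u : event R -> R) : Prop :=
  forall (s : seq (event R)) p,
    differentiable (foldr (fun v h => 'D_v h) u s) p.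

Definition smooth Psi : Prop :=
  smooth_real (fun p => complex.Re (Psi p)) /\
  smooth_real (fun p => complex.Im (Psi p)).

(* The velocity of the coordinate line of x^mu, with x^0 = ct: a unit increment
   of x^0 is an increment 1/c of t.  The index 0 is the time index and
   lift ord0 i, for i : 'I_3, are the space indices 1, 2, 3. *)
Definition coord_dir (c : R) (mu : 'I_4) : event R :=
  if unlift ord0 mu is Some i then (delta_mx i 0, 0) else (0, c^-1).

Definition partial (c : R) (mu : 'I_4) Psi : event R -> R[i] :=
  cderive (coord_dir c mu) Psi.

Definition wave_op (c : R) (a : 'M[R[i]]_4) (b : 'rV[R[i]]_4) f Psi p : R[i] :=
  \sum_(mu < 4) \sum_(nu < 4) a mu nu * partial c mu (partial c nu Psi) p
  + \sum_(mu < 4) b 0 mu * partial c mu Psi p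
  + f p * Psi p.

(* A time derivative survives once a^{mu nu} and a^{nu mu}, which multiply the
   same second-order derivative, have been combined. *)
Definition involves_time (a : 'M[R[i]]_4) (b : 'rV[R[i]]_4) : Prop :=
  [\/ a 0 0 != 0,
      exists i : 'I_3, a 0 (lift ord0 i) + a (lift ord0 i) 0 != 0
    | b 0 0 != 0].

(* In both relations the first event is unprimed and the second primed. *)
Definition rotation (M : 'M[R]_3) p p' : Prop := p'.1 = M *m p.1 /\ p'.2 = p.2.

Definition boost (w : 'cV[R]_3) p p' : Prop :=
  p.2 = p'.2 /\ p.1 = p'.1 + p'.2 *: w.

Definition SO3 (M : 'M[R]_3) : Prop := M^T *m M = 1%:M /\ \det M = 1.

(* Covariance under one change of frame with factor g.  As the frame relations
   are bijective, Psi and f' are determined by Psi', f and g. *)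
Definition covariant_under (c : R) (a : 'M[R[i]]_4) (b : 'rV[R[i]]_4) f
    (frames : event R -> event R -> Prop) g : Prop :=
  exists2 lam, (forall p', lam p' != 0) &
    forall Psi Psi' f', smooth Psi' ->
      (forall p p', frames p p' -> f' p' = f p) ->
      (forall p p', frames p p' -> Psi p = g p' * Psi' p') ->
      forall p p', frames p p' ->
        wave_op c a b f Psi p = lam p' * wave_op c a b f' Psi' p'.

Definition galilean_covariant (c : R) (a : 'M[R[i]]_4) (b : 'rV[R[i]]_4) f
    (g : 'cV[R]_3 -> event R -> R[i]) : Prop :=
  (forall M, SO3 M -> covariant_under c a b f (rotation M) (fun=> 1)) /\
  (forall w, [/\ smooth (g w), forall p', g w p' != 0
               & covariant_under c a b f (boost w) (g w)]).

End Galilean.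

(* Main.v *)
Require Import Defs.
From HB Require Import structures.
From mathcomp Require Import all_boot all_order all_algebra.
From mathcomp Require Import complex.
From mathcomp Require Import all_classical all_reals all_analysis.
From mathcomp Require Import ring.

(** At the origin, the operator applied to a real polynomial of degree at most
two only sees the linear form [sum b^mu l_mu], the quadratic form
[sum (a^{mu nu} + a^{nu mu}) m_mu n_nu] and the value of [f].  If the factor of
a boost is a constant [k], covariance says that these forms, pulled back by the
boost, are [r / k] times themselves for a single number [r].  The pullback along
the boost of unit velocity in direction [i] fixes the time covector [T] and
sends the space covector [X i] to [X i - T / c], so one obtains [r = k] from the
first nonvanishing one among [S(T, T)], [S(T, X i)], [b(T)], and then that this
entry vanishes after all.  Hence no time derivative survives. *)

Set Implicit Arguments.
Unset Strict Implicit.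
Unset Printing Implicit Defensive.

Import Order.TTheory GRing.Theory Num.Theory.
Import numFieldNormedType.Exports.
Local Open Scope ring_scope.
Local Open Scope complex_scope.

(** * Linear forms on events *)

Section Pairing.
Context {R : realType}.
Implicit Types (m n l v q : event R) (w : 'cV[R]_3) (k : R[i]).

(** Covectors are encoded as events through this dot product, so that directions and linear forms
    share one type. *)
Definition pairing m q : R := \sum_i m.1 i 0 * q.1 i 0 + m.2 * q.2.

Lemma pairingC m q : pairing m q = pairing q m.
Proof.
by rewrite /pairing mulrC; congr (_ + _); apply: eq_bigr => i _; rewrite mulrC.
Qed.

Lemma pairing_is_linear m : linear (pairing m : event R -> R).
Proof.
move=> x p q; rewrite /pairing /= scalerDr scaler_sumr addrACA -big_split /=.
congr (_ + _); last by rewrite mulrDr /GRing.scale /= mulrCA.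
by apply: eq_bigr => i _; rewrite !mxE mulrDr /GRing.scale /= mulrCA.
Qed.

HB.instance Definition _ m :=
  GRing.isLinear.Build R (event R) R _ (pairing m) (pairing_is_linear m).

Lemma pairing_linearl x m n q :
  pairing (x *: m + n) q = x * pairing m q + pairing n q.
Proof.
by rewrite pairingC pairing_is_linear [pairing q m]pairingC [pairing q n]pairingC.
Qed.

Lemma pairing0l q : pairing 0 q = 0.
Proof. by rewrite pairingC linear0. Qed.

Lemma pairing_continuous m : continuous (pairing m).
Proof.
move=> q; apply: cvgD.
  apply: cvg_big => [|i _]; first exact: add_continuous.
  apply: cvgMl_tmp.
  apply: (@continuous_comp _ _ _ fst (fun M : 'cV[R]_3 => M i 0)).
    exact: cvg_fst.
  exact: coord_continuous.
by apply: cvgMl_tmp; exact: cvg_snd.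
Qed.

Lemma pairing_differentiable m q : differentiable (pairing m) q.
Proof. exact/linear_differentiable/pairing_continuous. Qed.

Lemma is_derive_pairing m v q : is_derive q v (pairing m) (pairing m v).
Proof.
apply: DeriveDef; first exact/diff_derivable/pairing_differentiable.
rewrite deriveE ?diff_lin //; first exact: pairing_continuous.
exact: pairing_differentiable.
Qed.

(** * Test polynomials of degree at most two *)

Definition quadratic (x : R) l m n q : R :=
  x + pairing l q + pairing m q * pairing n q.

Lemma quadratic_differentiable x l m n q : differentiable (quadratic x l m n) q.
Proof.
apply: differentiableD; last first.
  by apply: differentiableM; exact: pairing_differentiable.
by apply: differentiableD; [exact: differentiable_cst|exact: pairing_differentiable].
Qed.

(** The product rule leaves a polynomial of the same shape, so the family is stable under
    directional derivatives. Smoothness then follows by induction on their number. *)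
Lemma derive_quadratic x l m n v :
  'D_v (quadratic x l m n) =
  quadratic (pairing l v) (pairing m v *: n + pairing n v *: m) 0 0.
Proof.
apply/funext => q.
have Hl := is_derive_pairing l v q.
have Hm := is_derive_pairing m v q.
have Hn := is_derive_pairing n v q.
rewrite (@derive_val _ _ _ _ _ _ _
  (is_deriveD (is_deriveD (is_derive_cst x q v) Hl) (is_deriveM Hm Hn))).
rewrite /quadratic pairing0l mulr0 addr0 add0r pairing_linearl.
rewrite -[pairing n v *: m]addr0 pairing_linearl pairing0l addr0.
by rewrite [X in _ = _ + X]addrC; congr (_ + (_ + _)); exact: mulrC.
Qed.

Lemma smooth_real_quadratic x l m n : smooth_real (quadratic x l m n).
Proof.
move=> s p; suff [y [l' [m' [n' ->]]]] : exists y l' m' n',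
    foldr (fun v h => 'D_v h) (quadratic x l m n) s = quadratic y l' m' n'.
  exact: quadratic_differentiable.
elim: s => [|v s [y [l' [m' [n' /= ->]]]]] /=; first by exists x, l, m, n.
by rewrite derive_quadratic; do 4 eexists.
Qed.

Lemma quadratic0 : quadratic 0 0 0 0 = cst 0.
Proof.
by apply/funext => q; rewrite /quadratic pairing0l mul0r !addr0.
Qed.

Lemma smooth_quadratic x l m n :
  smooth (fun q => (quadratic x l m n q)%:C).
Proof.
split => /=; first exact: smooth_real_quadratic.
(* The imaginary part is the zero function, itself a member of the family. *)
by rewrite -[X in smooth_real X]quadratic0; exact: smooth_real_quadratic.
Qed.

(** The complex [k] is carried along because a boost factor turns a real test polynomial into a
    complex multiple of one. *)
Lemma cderive_quadratic k x l m n v :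
  cderive v (fun q => k * (quadratic x l m n q)%:C) =
  fun q => k * (quadratic (pairing l v)
                  (pairing m v *: n + pairing n v *: m) 0 0 q)%:C.
Proof.
apply/funext => q; rewrite /cderive.
have dq : derivable (quadratic x l m n) q v.
  exact/diff_derivable/quadratic_differentiable.
case: k => kr ki.
have -> : (fun q => complex.Re ((kr +i* ki) * (quadratic x l m n q)%:C)) =
    kr *: quadratic x l m n.
  by apply/funext => p /=; rewrite mulr0 subr0.
have -> : (fun q => complex.Im ((kr +i* ki) * (quadratic x l m n q)%:C)) =
    ki *: quadratic x l m n.
  by apply/funext => p /=; rewrite mulr0 add0r.
by rewrite !deriveZ // -(derive_quadratic x); simpc.
Qed.

(** * Symbols of the operator and their behaviour under boosts *)

Variables (c : R) (a : 'M[R[i]]_4) (b : 'rV[R[i]]_4).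

Definition first_symbol l : R[i] :=
  \sum_(mu < 4) b 0 mu * (pairing l (coord_dir c mu))%:C.

(** The second-order part applied to the product of two linear forms. By symmetry it sees only the
    sums a^{mu nu} + a^{nu mu}, as [involves_time] does. *)
Definition second_symbol m n : R[i] :=
  \sum_(mu < 4) \sum_(nu < 4) a mu nu *
    (pairing m (coord_dir c nu) * pairing n (coord_dir c mu)
     + pairing n (coord_dir c nu) * pairing m (coord_dir c mu))%:C.

(** At the origin each homogeneous part of the polynomial meets exactly one part of the operator:
    the others either annihilate it or leave a positive power that vanishes there. *)
Lemma wave_op_quadratic f k x l m n :
  wave_op c a b f (fun q => k * (quadratic x l m n q)%:C) 0 =
  k * (second_symbol m n + first_symbol l + f 0 * x%:C).
Proof.
rewrite /wave_op !mulrDr; congr (_ + _ + _).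
- rewrite mulr_sumr; apply: eq_bigr => mu _.
  rewrite mulr_sumr; apply: eq_bigr => nu _.
  rewrite mulrCA /partial !cderive_quadratic.
  rewrite /quadratic !linear0 mulr0 !addr0.
  rewrite pairing_linearl -[pairing n (_ _ _) *: m]addr0 pairing_linearl.
  by rewrite pairing0l addr0.
- rewrite mulr_sumr; apply: eq_bigr => mu _.
  rewrite mulrCA /partial cderive_quadratic.
  by rewrite /quadratic !linear0 mulr0 !addr0.
- by rewrite /quadratic !linear0 mulr0 !addr0 mulrCA.
Qed.

(** Pullback of a linear form along the passage to the primed frame: as r' = r - t w, only the time
    component changes. *)
Definition boost_dual w m : event R :=
  (m.1, m.2 - pairing (m.1, 0) (w, 0)).

Lemma pairing_boost w m p p' : boost w p p' ->
  pairing (boost_dual w m) p = pairing m p'.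
Proof.
case: p p' => [r t] [r' t'] [/= -> ->].
rewrite /boost_dual /pairing /= mul0r addr0 mulrBl mulr_suml.
rewrite addrCA addrC -sumrB; congr (_ + _).
by apply: eq_bigr => i _; rewrite !mxE; ring.
Qed.

Lemma first_symbol_linear x l l' :
  first_symbol (x *: l + l') = x%:C * first_symbol l + first_symbol l'.
Proof.
rewrite /first_symbol mulr_sumr -big_split; apply: eq_bigr => mu _ /=.
by rewrite pairing_linearl rmorphD rmorphM /=; ring.
Qed.

Lemma second_symbolC m n : second_symbol m n = second_symbol n m.
Proof.
by do 2 apply: eq_bigr => ? _; rewrite addrC.
Qed.

Lemma second_symbol_linearr x m n n' : second_symbol m (x *: n + n') =
  x%:C * second_symbol m n + second_symbol m n'.
Proof.
rewrite /second_symbol mulr_sumr -big_split; apply: eq_bigr => mu _ /=.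
rewrite mulr_sumr -big_split; apply: eq_bigr => nu _ /=.
by rewrite !pairing_linearl !(rmorphD, rmorphM) /=; ring.
Qed.

(** Covariance is tested at the origin, which boosts fix, on polynomials without constant term, so
    that [f] drops out. The number [r] is the covariance factor there, hence common to both
    symbols. *)
Lemma boost_symbols f w k :
  covariant_under c a b f (boost w) (fun=> k) ->
  exists r, (forall l, k * first_symbol (boost_dual w l) = r * first_symbol l)
    /\ (forall m n, k * second_symbol (boost_dual w m) (boost_dual w n)
        = r * second_symbol m n).
Proof.
case=> lam _ cov; exists (lam 0).
have b0 : boost w 0 0 by split; rewrite //= scale0r addr0.
suff key l m n : k * (second_symbol (boost_dual w m) (boost_dual w n)
      + first_symbol (boost_dual w l)) =
    lam 0 * (second_symbol m n + first_symbol l).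
  (* Linearity with scalar -1 at zero vectors shows the value to be minus itself plus itself. *)
  have s20 n : second_symbol 0 n = 0.
    rewrite second_symbolC; move: (second_symbol_linearr (-1) n 0 0).
    by rewrite scaler0 addr0 rmorphN1 mulN1r addNr.
  have s10 : first_symbol 0 = 0.
    move: (first_symbol_linear (-1) 0 0).
    by rewrite scaler0 addr0 rmorphN1 mulN1r addNr.
  have d0 : boost_dual w 0 = 0.
    by congr (_, _); rewrite /= (_ : (0, 0) = 0 :> event R) // pairing0l subr0.
  split=> [l|m n].
    by move: (key l 0 0); rewrite !d0 s20 !add0r.
  by move: (key 0 m n); rewrite !d0 s10 !addr0.
(* The unprimed function is [k] times the pulled-back polynomial, and the third argument is [f] read
   at the unprimed event. *)
have := cov (fun q => k * (quadratic 0 (boost_dual w l) (boost_dual w m)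
    (boost_dual w n) q)%:C) (fun q => (quadratic 0 l m n q)%:C)
  (fun q => f (q.1 + q.2 *: w, q.2)) (smooth_quadratic _ _ _ _).
move=> /(_ _ _ 0 0 b0).
have -> : (fun q => (quadratic 0 l m n q)%:C) =
    (fun q => 1 * (quadratic 0 l m n q)%:C) by apply/funext => q; rewrite mul1r.
rewrite !wave_op_quadratic mul1r !mulr0 !addr0; apply.
  by move=> [r t] [r' t'] [/= -> ->].
by move=> p p' hp; rewrite /quadratic !(pairing_boost _ hp).
Qed.

(** * Covectors dual to the coordinate directions *)

Definition time_covector : event R := (0, c).
Definition space_covector (i : 'I_3) : event R := (delta_mx i 0, 0).

Hypothesis c_neq0 : c != 0.

Lemma pairing_time mu : pairing time_covector (coord_dir c mu) = (mu == 0)%:R.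
Proof.
rewrite /pairing /= big1 ?add0r; last by move=> i _; rewrite mxE mul0r.
rewrite /coord_dir; case: unliftP => [i ->|->] /=.
  by rewrite mulr0.
by rewrite divff.
Qed.

Lemma pairing_space i mu :
  pairing (space_covector i) (coord_dir c mu) = (mu == lift ord0 i)%:R.
Proof.
rewrite /pairing /= mul0r addr0 (bigD1 i) //= big1 ?addr0; last first.
  by move=> j /negPf ji; rewrite mxE ji mul0r.
rewrite mxE !eqxx mul1r /coord_dir; case: unliftP => [j ->|->] /=.
  by rewrite mxE andbT (inj_eq lift_inj) eq_sym.
by rewrite mxE.
Qed.

Lemma first_symbol_time : first_symbol time_covector = b 0 0.
Proof.
rewrite /first_symbol (bigD1 0) //= big1 ?addr0.
  by rewrite pairing_time mulr1.
by move=> mu /negPf mu0; rewrite pairing_time mu0 mulr0.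
Qed.

Lemma second_symbol_delta m n al be :
  (forall mu, pairing m (coord_dir c mu) = (mu == al)%:R) ->
  (forall mu, pairing n (coord_dir c mu) = (mu == be)%:R) ->
  second_symbol m n = a al be + a be al.
Proof.
move=> hm hn.
(* Each half of the symmetrised sum is weighted by two Kronecker deltas and collapses to one entry
   of [a]. *)
have E (x y : 'I_4) :
    \sum_mu \sum_nu a mu nu * ((nu == y)%:R * (mu == x)%:R) = a x y.
  rewrite (bigD1 x) //= [X in _ + X]big1 ?addr0; last first.
    move=> mu /negPf mux; apply: big1 => nu _.
    by rewrite mux !mulr0.
  rewrite (bigD1 y) //= big1 ?addr0 ?eqxx ?mulr1 //.
  by move=> nu /negPf ->; rewrite mul0r mulr0.
rewrite -[a al be]E -[a be al]E addrC -big_split; apply: eq_bigr => mu _.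
rewrite -big_split; apply: eq_bigr => nu _ /=.
by rewrite !hm !hn rmorphD !rmorphM !rmorph_nat mulrDr.
Qed.

Lemma boost_dual_time w : boost_dual w time_covector = time_covector.
Proof.
by congr (_, _); rewrite /= (_ : (0, 0) = 0 :> event R) // pairing0l subr0.
Qed.

(** Unit velocity subtracts t from x^i, and t is [c^-1] times the coordinate x^0 represented by
    [time_covector]. *)
Lemma boost_dual_space i : boost_dual (delta_mx i 0) (space_covector i) =
  (- c^-1) *: time_covector + space_covector i.
Proof.
congr (_, _) => /=; first by rewrite scaler0 add0r.
rewrite sub0r addr0 /pairing /= mul0r addr0 (bigD1 i) //= big1 ?addr0; last first.
  by move=> j /negPf ji; rewrite mxE ji mul0r.
by rewrite mxE !eqxx mulr1 /GRing.scale /= mulNr mulVf.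
Qed.

End Pairing.

Theorem theorem2 (R : realType) (c : R) (hc : 0 < c) :
  ~ exists (a : 'M[R[i]]_4) (b : 'rV[R[i]]_4) (f : event R -> R[i])
      (g : 'cV[R]_3 -> event R -> R[i]),
    [/\ involves_time a b,
        galilean_covariant c a b f g
      & forall w : 'cV[R]_3, exists k : R[i], forall p' : event R, g w p' = k].
Proof.
case=> a [b [f [g [inv [_ hboost] gconst]]]].
have c0 : c != 0 by rewrite gt_eqF.
set T := time_covector c; set X := @space_covector R.
have d0 : (- c^-1)%:C != 0 :> R[i] by rewrite fmorph_eq0 oppr_eq0 invr_eq0.
pose S2 := second_symbol c a; pose S1 := first_symbol c b.
(* The transformed symbols are expanded by bilinearity on [T] and [X i]. The numbers [k] and [r] may
   depend on the direction [i]. *)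
have sym i : exists k r : R[i], [/\ k != 0,
    [/\ k * S2 T T = r * S2 T T,
       k * ((- c^-1)%:C * S2 T T + S2 T (X i)) = r * S2 T (X i) &
       k * ((- c^-1)%:C * ((- c^-1)%:C * S2 T T + S2 T (X i))
            + ((- c^-1)%:C * S2 T (X i) + S2 (X i) (X i)))
       = r * S2 (X i) (X i)],
    k * S1 T = r * S1 T &
    k * ((- c^-1)%:C * S1 T + S1 (X i)) = r * S1 (X i)].
  have [k gk] := gconst (delta_mx i 0); exists k.
  have [_ gn0] := hboost (delta_mx i 0).
  have -> : g (delta_mx i 0) = fun=> k by apply/funext.
  case/boost_symbols => r [h1 h2]; exists r.
  have E : boost_dual (delta_mx i 0) (X i) = (- c^-1) *: T + X i.
    exact: boost_dual_space.
  have ET : boost_dual (delta_mx i 0) T = T by exact: boost_dual_time.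
  split.
  - by rewrite -(gk 0).
  - split.
    + by move: (h2 T T); rewrite ET.
    + by move: (h2 T (X i)); rewrite ET E second_symbol_linearr.
    + move: (h2 (X i) (X i)); rewrite E second_symbol_linearr.
      by rewrite ![second_symbol _ _ (_ + _) _]second_symbolC !second_symbol_linearr
        [second_symbol _ _ (X i) T]second_symbolC.
  - by move: (h1 T); rewrite ET.
  - by move: (h1 (X i)); rewrite E first_symbol_linear.
(* An invariant nonzero [x] forces r = k; then the shift of [y] by a nonzero multiple of [x] would
   have to vanish. *)
have cancel (k r x y : R[i]) : k != 0 -> x != 0 -> k * x = r * x ->
    k * ((- c^-1)%:C * x + y) = r * y -> False.
  move=> k0 x0 /(mulIf x0) <- /(mulfI k0) /eqP.
  by rewrite -subr_eq0 addrK mulf_eq0 (negPf d0) (negPf x0).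
have TT0 : S2 T T = 0.
  apply/eqP/negPn/negP => x0.
  by have [k [r [k0 [e1 e2 _] _ _]]] := sym ord0; exact: (cancel _ _ _ _ k0 x0 e1 e2).
have TX0 i : S2 T (X i) = 0.
  apply/eqP/negPn/negP => x0.
  have [k [r [k0 [_ + +] _ _]]] := sym i.
  rewrite TT0 mulr0 add0r => e1 e2.
  (* With [S2 T T] gone, [S2 (X i) (X i)] is shifted by both cross terms, whence the doubled
     [S2 T (X i)] as invariant. *)
  apply: (cancel k r (S2 T (X i) + S2 T (X i)) (S2 (X i) (X i)) k0).
  - by rewrite -mulr2n mulrn_eq0.
  - by rewrite !mulrDr e1.
  - by rewrite -e2 [_ * (_ + S2 T _)]mulrDr addrA.
have T0 : S1 T = 0.
  apply/eqP/negPn/negP => x0.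
  by have [k [r [k0 _ e1 e2]]] := sym ord0; exact: (cancel _ _ _ _ k0 x0 e1 e2).
have pT := pairing_time c0; have pX := @pairing_space R c.
case: inv => [|[j]|].
(* On the diagonal the symmetrised entry is twice [a 0 0], so characteristic zero is used. *)
- move: TT0; rewrite /S2 (second_symbol_delta a pT pT) => /eqP.
  by rewrite -mulr2n mulrn_eq0 /= => /eqP ->; rewrite eqxx.
- by rewrite -(second_symbol_delta a pT (pX j)) [second_symbol _ _ _ _]TX0 eqxx.
- by rewrite -(first_symbol_time b c0) [first_symbol _ _ _]T0 eqxx.
Qed.
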